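(* Let $x^0,x^1,x^2,\dots$ be a sequence generated by the RCSD algorithm (described in the context) for minimizing $F=f+\phi-h$, with stepsizes $\gamma_1,\dots,\gamma_m$ and sampling probabilities $p_1,\dots,p_m$. 1. Assume that $\gamma_i>\frac{L_i}{2}$ for all $i\in[m]$. Then the sequence $\{x^k\}$ is bounded and, almost surely, every limit point of the sequence is a critical point of $F$. 2. Assume that $\gamma_i=L_i$ for all $i\in[m]$ and that blocks are sampled with probability $p_i\propto L_i^{1-s}$, where $0\le s\le 1$. Then for every $K\ge 0$ $$\min_{0\le k\le K}\mathbb{E}\,\|g(x^{k},\nabla f(x^{k})-v^{k},\gamma)\|_{[s],*}^{2}\le\frac{2\bigl(\sum_{j=1}^{m}L_{j}^{1-s}\bigr)\,[F(x^{0})-F(x^{*})]}{K+1},$$ where the expectation is with respect to $i_0,i_1,\dots,i_K$.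
   Context: Notation. $[m]=\{1,\dots,m\}$. $d=\sum_{i=1}^m d_i$, and $U_i\in\mathbb{R}^{d\times d_i}$ are such that $[U_1,\dots,U_m]=I_d$. For $x\in\mathbb{R}^d$, $x_i=U_i^Tx\in\mathbb{R}^{d_i}$ is the $i$-th block, so $x=\sum_i U_ix_i$; $\nabla_i f(x)=U_i^T\nabla f(x)$. $\|\cdot\|_i$ is the Euclidean norm on $\mathbb{R}^{d_i}$, $\|\cdot\|$ the Euclidean norm on $\mathbb{R}^d$. For $s\in[0,1]$, $\|y\|_{[s],*}=\sqrt{\sum_{i=1}^m L_i^{-s}\|y_i\|_i^2}$. Standing assumptions. The problem is $\min_{x\in\mathbb{R}^d}F(x)=f(x)+\phi(x)-h(x)$, where: (i) $f:\mathbb{R}^d\to\mathbb{R}$ is continuously differentiable and block-wise Lipschitz smooth with constants $L_1,\dots,L_m>0$: $\|\nabla_i f(x)-\nabla_i f(x+U_it)\|_i\le L_i\|t\|_i$ for all $x\in\mathbb{R}^d$, $t\in\mathbb{R}^{d_i}$, $i\in[m]$; (ii) $\phi(x)=\sum_{i=1}^m\phi_i(x_i)$ with each $\phi_i:\mathbb{R}^{d_i}\to\mathbb{R}$ proper, convex, lower semicontinuous; (iii) $h:\mathbb{R}^d\to\mathbb{R}$ is convex and continuous; (iv) every lower level set $\{x:F(x)\le r\}$, $r\in\mathbb{R}$, is bounded; (v) there is $x^*$ with $F(x^* )=\min_xF(x)>-\infty$. A point $x$ is a critical point of $F$ if $[\nabla f(x)+\partial\phi(x)]\cap\partial h(x)\ne\emptyset$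 (convex subdifferentials). For $\gamma=(\gamma_1,\dots,\gamma_m)$ with positive entries and $\bar x_i,y_i\in\mathbb{R}^{d_i}$ define $$\mathcal{P}_i(\bar x_i,y_i,\gamma_i)=\operatorname{argmin}_{x\in\mathbb{R}^{d_i}}\Bigl\{\langle y_i,x\rangle+\phi_i(x)+\tfrac{\gamma_i}{2}\|\bar x_i-x\|_i^2\Bigr\}.$$ For $v\in\partial h(x)$ define $g_i(x,\nabla_if(x)-v_i,\gamma_i)=\gamma_i\bigl(x_i-\mathcal{P}_i(x_i,\nabla_if(x)-v_i,\gamma_i)\bigr)$ and the composite subgradient $g(x,\nabla f(x)-v,\gamma)=\sum_{i=1}^mU_ig_i(x,\nabla_if(x)-v_i,\gamma_i)$. RCSD algorithm. Input $x^0\in\mathbb{R}^d$, stepsizes $\gamma_i>0$, and a probability vector $(p_1,\dots,p_m)$ with all $p_i>0$. For $k=0,1,2,\dots$: take $v^k\in\partial h(x^k)$ (chosen from the history $i_0,\dots,i_{k-1}$); sample $i_k\in[m]$ independently of the past with $\Pr(i_k=i)=p_i$; set $x^{k+1}_{i_k}=\mathcal{P}_{i_k}\bigl(x^k_{i_k},\nabla_{i_k}f(x^k)-v^k_{i_k},\gamma_{i_k}\bigr)$ and $x^{k+1}_j=x^k_j$ for $j\ne i_k$. *)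

(* Defs.v *)
From HB Require Import structures.
From mathcomp Require Export all_boot all_order all_algebra.
From mathcomp Require Export all_classical all_reals all_analysis.
Export Order.TTheory GRing.Theory Num.Theory.
Export numFieldNormedType.Exports.

Set Implicit Arguments.
Unset Strict Implicit.
Unset Printing Implicit Defensive.

Local Open Scope classical_set_scope.
Local Open Scope ring_scope.

Section Euclidean.
Variables (R : realType) (n : nat).
Implicit Types (x y v : 'cV[R]_n).

Definition dotv x y : R := \sum_j x j 0 * y j 0.

(* The norm [`|x|] that the library puts on matrices is the sup norm: it is
   used below only through the topology and the bounded sets it induces. *)
Definition enorm x : R := Num.sqrt (dotv x x).

Definition grad (f : 'cV[R]_n -> R) x : 'cV[R]_n :=
  \col_j 'D_(delta_mx j 0) f x.

Definition continuously_differentiable (f : 'cV[R]_n -> R) : Prop :=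
  (forall x, differentiable f x) /\ continuous (grad f).

Definition proper (phi : 'cV[R]_n -> \bar R) : Prop :=
  (forall x, phi x != -oo%E) /\ (exists x, phi x != +oo%E).

Definition subdiff (h : 'cV[R]_n -> R) x : set 'cV[R]_n :=
  [set v | forall y, h x + dotv v (y - x) <= h y].

Definition argmin (h : 'cV[R]_n -> R) : set 'cV[R]_n :=
  [set x | forall y, h x <= h y].

(* When phi is convex and 0 < gam the minimizer exists and is unique; outside
   of this case [get] returns an arbitrary minimizer, or a default value. *)
Definition prox (phi : 'cV[R]_n -> R) (xbar y : 'cV[R]_n) (gam : R) :
    'cV[R]_n :=
  get (argmin (fun x => dotv y x + phi x + gam / 2 * enorm (xbar - x) ^+ 2)).

End Euclidean.

Section Blocks.
Variables (R : realType) (m : nat) (d_ : 'I_m -> nat).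
Local Notation d := (\sum_(i < m) d_ i)%N.
Variable U : forall i : 'I_m, 'M[R]_(d, d_ i).
Implicit Types (f h : 'cV[R]_d -> R) (phi : forall i, 'cV[R]_(d_ i) -> R).
Implicit Types (x v y : 'cV[R]_d) (L gam : 'I_m -> R).

Definition blk i x : 'cV[R]_(d_ i) := (U i)^T *m x.

Definition block_smooth f L : Prop :=
  forall i x (t : 'cV[R]_(d_ i)),
    enorm (blk i (grad f x) - blk i (grad f (x + U i *m t))) <= L i * enorm t.

Definition separable phi x : R := \sum_(i < m) phi i (blk i x).

Definition objective f phi h x : R := f x + separable phi x - h x.

Definition critical f phi h : set 'cV[R]_d :=
  [set x | [set grad f x + u | u in subdiff (separable phi) x]
             `&` subdiff h x !=set0].

Definition block_update f phi gam x v i : 'cV[R]_(d_ i) :=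
  prox (phi i) (blk i x) (blk i (grad f x) - blk i v) (gam i).

Definition composite_subgrad f phi gam x v : 'cV[R]_d :=
  \sum_(i < m) U i *m (gam i *: (blk i x - block_update f phi gam x v i)).

Definition dual_norm L (s : R) y : R :=
  Num.sqrt (\sum_(i < m) L i `^ (- s) * enorm (blk i y) ^+ 2).

End Blocks.

Section Algorithm.
Variables (R : realType) (m : nat) (d_ : 'I_m -> nat).
Local Notation d := (\sum_(i < m) d_ i)%N.
Variables (disp : measure_display) (T : measurableType disp).
Implicit Types (I : nat -> T -> 'I_m) (x v : nat -> T -> 'cV[R]_d).

Definition history I (k : nat) (w : T) : k.-tuple 'I_m :=
  [tuple I l w | l < k].

Record independent_sampling (P : probability T R) (p : 'I_m -> R) I : Prop := {
  sampling_measurable : forall k i, measurable [set w | I k w = i];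
  sampling_law : forall k i, P [set w | I k w = i] = (p i)%:E;
  sampling_indep : forall k i (A : {set k.-tuple 'I_m}),
    P ([set w | I k w = i] `&` [set w | history I k w \in A]) =
    (P [set w | I k w = i] * P [set w | history I k w \in A])%E }.

Record RCSD (U : forall i, 'M[R]_(d, d_ i)) (f : 'cV[R]_d -> R)
    (phi : forall i, 'cV[R]_(d_ i) -> R) (h : 'cV[R]_d -> R)
    (gam : 'I_m -> R) (x0 : 'cV[R]_d) I x v : Prop := {
  rcsd_init : forall w, x 0 w = x0;
  rcsd_history : forall k, exists c : k.-tuple 'I_m -> 'cV[R]_d,
    forall w, v k w = c (history I k w);
  rcsd_subgrad : forall k w, subdiff h (x k w) (v k w);
  rcsd_update : forall k w, blk U (I k w) (x k.+1 w) =
    block_update U f phi gam (x k w) (v k w) (I k w);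
  rcsd_keep : forall k w j, j != I k w ->
    blk U j (x k.+1 w) = blk U j (x k w) }.

End Algorithm.

(* Main.v *)
Require Import Defs.
From mathcomp Require Import measurable_realfun ring lra.

Set Implicit Arguments.
Unset Strict Implicit.
Unset Printing Implicit Defensive.

Local Open Scope classical_set_scope.
Local Open Scope ring_scope.

(** The engine is one inequality: if block i is replaced by its proximal point
    q, the objective falls by at least (gam i - L i / 2) * |x_i - q|^2
    ([block_step_decrease]).  Three bounds add up to it: the descent lemma for
    the smooth term, [block_descent]; the optimality condition of the strongly
    convex proximal problem, [prox_subgrad], which also pays for the linear
    terms; and the subgradient inequality for the subtracted convex term,
    which is linearized from below.  Since every run decreases the objective,
    it stays in a bounded level set.

    Randomness enters only through the choice of the block.  The iterate and
    its subgradient are functions of the finite history i_0, ..., i_(k-1), so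
    every expectation is a finite sum and conditioning on the past amounts to
    [integral_next_choice]: inside an integral, a quantity read at the sampled
    block may be replaced by its p-weighted mean over all blocks.  Telescoping
    bounds the sum over k of the expected mean squared steps by
    F(x0) - min F ([expected_decrease]).

    Critical limit points.  A series of nonnegative functions with bounded
    total integral converges almost everywhere, so almost surely every block
    step, sampled or not, tends to 0 (all p_i are positive).  On such a run,
    refine the filter of large k so that x^k tends to a given cluster point;
    the subgradients v^k are bounded because h is bounded near the run, hence
    a further refinement makes them converge.  The proximal points have the
    same limits as the blocks x^k_i, and both subgradient inequalities pass to
    the limit by lower semicontinuity ([limit_points_critical]).

    Rate.  With gam = L and p_i proportional to L_i^(1-s), the p-weighted mean
    decrease is exactly the squared dual norm of the composite subgradient
    divided by twice the sum of the L_j^(1-s), and a minimum is at most an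
    average. *)

(** * Euclidean norm, sup norm and limits of column vectors *)

Lemma cvg_sumr {R : realType} (X : Type) (F : set_system X) {FF : Filter F}
    (J : Type) (r : seq J) (u : J -> X -> R) (l : J -> R) :
  (forall j, u j @ F --> l j) ->
  (fun t => \sum_(j <- r) u j t) @ F --> \sum_(j <- r) l j.
Proof.
move=> ul; elim: r => [|j r IH].
  by rewrite big_nil; under eq_fun do rewrite big_nil; exact: cvg_cst.
by rewrite big_cons; under eq_fun do rewrite big_cons; exact: cvgD.
Qed.

Lemma subl_continuous {K : numFieldType} {V : normedModType K} (a : V) :
  continuous (fun z => a - z).
Proof. by move=> z; apply: cvgB; [exact: cvg_cst | exact: cvg_id]. Qed.

Lemma norm_subl_continuous {K : numFieldType} {V : normedModType K} (a : V) :
  continuous (fun z => `|a - z| : K).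
Proof. by move=> z; apply: cvg_norm; exact: subl_continuous. Qed.

Section Inner.
Context {R : realType} {n : nat}.
Implicit Types (x y z : 'cV[R]_n) (a c : R).

Lemma dotvC x y : dotv x y = dotv y x.
Proof. by apply: eq_bigr => j _; rewrite mulrC. Qed.

Lemma dotvDl x y z : dotv (x + y) z = dotv x z + dotv y z.
Proof. by rewrite -big_split; apply: eq_bigr => j _; rewrite mxE mulrDl. Qed.

Lemma dotvZl a x y : dotv (a *: x) y = a * dotv x y.
Proof. by rewrite mulr_sumr; apply: eq_bigr => j _; rewrite mxE mulrA. Qed.

Lemma dotvNl x y : dotv (- x) y = - dotv x y.
Proof. by rewrite -scaleN1r dotvZl mulN1r. Qed.

Lemma dotvBl x y z : dotv (x - y) z = dotv x z - dotv y z.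
Proof. by rewrite dotvDl dotvNl. Qed.

Lemma dotvDr x y z : dotv x (y + z) = dotv x y + dotv x z.
Proof. by rewrite !(dotvC x) dotvDl. Qed.

Lemma dotvZr a x y : dotv x (a *: y) = a * dotv x y.
Proof. by rewrite !(dotvC x) dotvZl. Qed.

Lemma dotvNr x y : dotv x (- y) = - dotv x y.
Proof. by rewrite !(dotvC x) dotvNl. Qed.

Lemma dotvBr x y z : dotv x (y - z) = dotv x y - dotv x z.
Proof. by rewrite dotvDr dotvNr. Qed.

Lemma dotv0r x : dotv x 0 = 0.
Proof. by rewrite /dotv big1 // => j _; rewrite mxE mulr0. Qed.

Lemma dotv_ge0 x : 0 <= dotv x x.
Proof. by apply: sumr_ge0 => j _; rewrite -expr2 sqr_ge0. Qed.

Lemma enorm_sqr x : enorm x ^+ 2 = dotv x x.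
Proof. by rewrite sqr_sqrtr ?dotv_ge0. Qed.

Lemma enorm_ge0 x : 0 <= enorm x.
Proof. exact: sqrtr_ge0. Qed.

Lemma enorm_sqrB x y :
  enorm (x - y) ^+ 2 = dotv x x - 2 * dotv x y + dotv y y.
Proof. by rewrite enorm_sqr dotvBl !dotvBr (dotvC y x); ring. Qed.

(** The form of Cauchy-Schwarz used by the descent lemma: expanding
    |x - c y|^2 >= 0 gives it without dividing by a norm. *)
Lemma dotv_le_of_enorm x y c : 0 < c -> enorm x <= c * enorm y ->
  dotv x y <= c * dotv y y.
Proof.
move=> c0 xy; rewrite -(ler_pM2l c0).
have H : enorm x ^+ 2 <= c ^+ 2 * dotv y y.
  rewrite -enorm_sqr -exprMn ler_pXn2r // nnegrE ?enorm_ge0 //.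
  by rewrite mulr_ge0 ?enorm_ge0 // ltW.
have := dotv_ge0 (x - c *: y).
rewrite dotvBl !dotvBr !dotvZl !dotvZr (dotvC y x) -enorm_sqr.
move: H; rewrite expr2; set A := enorm x ^+ 2; lra.
Qed.

Lemma coord_le_norm x j : `|x j 0| <= `|x|.
Proof.
by rewrite [leRHS]/Num.norm /= mx_normrE; apply/bigmax_geP; right => /=; exists (j, 0).
Qed.

(** The topology of vectors is that of the sup norm; this and [cvg0_enorm]
    carry Euclidean estimates over to it. *)
Lemma norm_sqr_le x : `|x| ^+ 2 <= dotv x x.
Proof.
have [x0|x0] := eqVneq `|x| 0; first by rewrite x0 expr0n /= dotv_ge0.
have [[i k]] := mx_norm_neq0 x0; rewrite /= ord1 {x0} => xi.
rewrite [`|x|]xi real_normK ?num_real //.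
rewrite /dotv (bigD1 i) //= -expr2 lerDl.
by apply: sumr_ge0 => j _; rewrite -expr2 sqr_ge0.
Qed.

Lemma norm_le_coord x c : 0 <= c -> (forall j, `|x j 0| <= c) -> `|x| <= c.
Proof.
move=> c0 xc; have [x0|x0] := eqVneq `|x| 0; first by rewrite x0.
by have [[i k]] := mx_norm_neq0 x0; rewrite /= ord1 => xi; rewrite [`|x|]xi.
Qed.

Lemma cvg_cV (X : Type) (F : set_system X) {FF : Filter F} (u : X -> 'cV[R]_n)
    (l : 'cV[R]_n) :
  (forall j, (fun t => u t j 0) @ F --> l j 0) -> u @ F --> l.
Proof.
move=> ul; apply/cvg_ballP => e e0.
have H : \forall t \near F, forall j, ball (l j 0) e (u t j 0).
  apply: filter_forall => j; exact: (cvg_ball (ul j) e0).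
near=> t; split => // i k; rewrite ord1.
by move: i; near: t.
Unshelve. all: by end_near. Qed.

Lemma cvg_coord (X : Type) (F : set_system X) {FF : Filter F} (u : X -> 'cV[R]_n)
    (l : 'cV[R]_n) j : u @ F --> l -> (fun t => u t j 0) @ F --> l j 0.
Proof. exact: (continuous_cvg _ (@coord_continuous R n 1 j 0 l)). Qed.

Lemma cvg0_enorm {S : Type} (G : set_system S) {GG : Filter G} (u : S -> 'cV[R]_n) :
  (fun s => enorm (u s) ^+ 2) @ G --> 0 -> u @ G --> (0 : 'cV[R]_n).
Proof.
move=> u0; apply/cvgr0Pnorm_lt => e e0.
have : \forall s \near G, enorm (u s) ^+ 2 < e ^+ 2.
  by apply: (cvgr_lt 0 u0); rewrite exprn_gt0.
apply: filterS => s us; rewrite -(ltr_pXn2r (ltn0Sn 1)) ?nnegrE ?(ltW e0) //.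
by apply: le_lt_trans us; rewrite enorm_sqr norm_sqr_le.
Qed.

Lemma cvg_dotv (X : Type) (F : set_system X) {FF : Filter F}
    (u w : X -> 'cV[R]_n) (a b : 'cV[R]_n) :
  u @ F --> a -> w @ F --> b -> (fun t => dotv (u t) (w t)) @ F --> dotv a b.
Proof.
move=> ua wb; apply: cvg_sumr => j; apply: cvgM; exact: cvg_coord.
Qed.

Lemma continuous_dotv (X : topologicalType) (u w : X -> 'cV[R]_n) :
  continuous u -> continuous w -> continuous (fun t => dotv (u t) (w t)).
Proof. by move=> cu cw t; apply: cvg_dotv; [exact: cu | exact: cw]. Qed.

(** A bounded closed set lies in the transpose of a cube of row vectors, which
    is compact by Tychonoff's theorem. *)
Lemma bounded_closed_compact_cV (A : set 'cV[R]_n) :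
  bounded_set A -> closed A -> compact A.
Proof.
move=> [M [_ AM]] Acl.
have K : compact [set r : 'rV[R]_n | forall i, r ord0 i \in `[(- (M + 1)), (M + 1)]].
  apply: (@rV_compact _ _ (fun=> `[(- (M + 1)), (M + 1)]%classic)).
  by move=> _; exact: segment_compact.
have trc : continuous (fun r : 'rV[R]_n => r^T : 'cV[R]_n).
  move=> r; apply: (@cvg_cV _ (nbhs r) _ (fun r => r^T)) => j.
  by under eq_fun do rewrite mxE; rewrite mxE; exact: coord_continuous.
have KT := continuous_compact (continuous_subspaceT trc) K.
apply: (subclosed_compact Acl KT) => x Ax; exists x^T; last by rewrite trmxK.
move=> i /=; rewrite mxE in_itv /= -ler_norml.
by apply: le_trans (coord_le_norm x i) (AM _ _ _ Ax); rewrite ltrDl.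
Qed.

End Inner.

Lemma mulmx_cvg {R : realType} {n q : nat} (A : 'M[R]_(q, n))
    (X : Type) (F : set_system X) {FF : Filter F} (u : X -> 'cV[R]_n)
    (l : 'cV[R]_n) :
  u @ F --> l -> (fun t => A *m u t) @ F --> A *m l.
Proof.
move=> ul; apply: cvg_cV => j; rewrite mxE; under eq_fun do rewrite mxE.
by apply: cvg_sumr => k; apply: cvgMl_tmp; exact: cvg_coord.
Qed.

Lemma dotv_mulmxE {R : realType} {n : nat} (x y : 'cV[R]_n) :
  dotv x y = (x^T *m y) 0 0.
Proof. by rewrite mxE; apply: eq_bigr => j _; rewrite mxE. Qed.

Lemma dotv_mulmxr {R : realType} {n q : nat} (A : 'M[R]_(n, q)) x y :
  dotv x (A *m y) = dotv (A^T *m x) y.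
Proof. by rewrite !dotv_mulmxE trmx_mul trmxK mulmxA. Qed.

(** * Lower semicontinuous functions and limits along filters *)

Lemma lower_semicontinuousD_continuous {R : realType} {X : topologicalType}
    (f g : X -> R) : lower_semicontinuous (EFin \o f) -> continuous g ->
  lower_semicontinuous (EFin \o (f \+ g)).
Proof.
move=> lf cg x a /=; rewrite lte_fin => axy.
pose e := (f x + g x - a) / 2.
have e0 : 0 < e by rewrite divr_gt0 // subr_gt0.
have [|V Vx fV] := lf x (f x - e); first by rewrite lte_fin ltrBlDr ltrDl.
have gV : \forall y \near x, g x - e < g y.
  have := cvgr_gt (g x) (cg x); apply; by rewrite ltrBlDr ltrDl.
exists (V `&` [set y | g x - e < g y]); first exact: filterI.
move=> y [/fV /=]; rewrite !lte_fin => fy gy.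
by move: fy gy; rewrite /e; lra.
Qed.

Lemma continuous_lower_semicontinuous {R : realType} {X : topologicalType}
    (f : X -> R) : continuous f -> lower_semicontinuous (EFin \o f).
Proof.
move=> cf x a /=; rewrite lte_fin => ax.
exists [set y | a < f y]; first exact: (cvgr_gt (f x) (cf x)).
by move=> y /=; rewrite lte_fin.
Qed.

(** The sublevel sets of the values of f on K generate a proper filter; a
    cluster point of it lies in all of them, for otherwise lower
    semicontinuity keeps one of them away from a neighbourhood of the point. *)
Lemma lower_semicontinuous_compact_min {R : realType} {X : ptopologicalType}
    (f : X -> R) (K : set X) : lower_semicontinuous (EFin \o f) ->
  compact K -> K !=set0 -> exists2 x, K x & forall y, K y -> f x <= f y.
Proof.
move=> lf cK [x0 Kx0].
pose sub y := K `&` [set x | f x <= f y].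
have FF : ProperFilter (filter_from K sub).
  apply: filter_from_proper; last by move=> y Ky; exists y; split => /=.
  apply: filter_from_filter; first by exists x0.
  move=> y z Ky Kz; have [yz|zy] := leP (f y) (f z).
    exists y => // x [Kx /= xy]; split; split => //=; exact: le_trans yz.
  exists z => // x [Kx /= xz]; split; split => //=; exact: le_trans (ltW zy).
have [|p [Kp clp]] := cK _ FF; first by exists x0 => // x [].
exists p => // y Ky; rewrite leNgt; apply/negP => yp.
have [|V pV fV] := lf p (f y); first by rewrite lte_fin.
have [x [[_ /= xy] /fV]] := clp _ _ (ex_intro2 _ _ y Ky (@subset_refl _ _)) pV.
by rewrite /= lte_fin ltNge xy.
Qed.

(** Used with a linear c, to pass to the limit in a subgradient inequality
    whose base point moves. *)
Lemma lower_semicontinuous_limit_le {R : realType} {X : topologicalType}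
    {S : Type} (G : set_system S) {GG : ProperFilter G} (f : X -> R)
    (u : S -> X) (c : S -> R) (l : X) (c0 M : R) :
  lower_semicontinuous (EFin \o f) -> u @ G --> l -> c @ G --> c0 ->
  (forall s, f (u s) + c s <= M) -> f l + c0 <= M.
Proof.
move=> lf ul cc H; rewrite leNgt; apply/negP => Mlt.
pose e := (f l + c0 - M) / 2.
have e0 : 0 < e by rewrite divr_gt0 // subr_gt0.
have [|V lV fV] := lf l (f l - e); first by rewrite lte_fin ltrBlDr ltrDl.
have Gu : G [set s | V (u s)] by exact: ul.
have Gc : G [set s | c0 - e < c s].
  by apply: (cvgr_gt c0 cc); rewrite ltrBlDr ltrDl.
have [s [/fV /= us cs]] := filter_ex (filterI Gu Gc).
move: us cs (H s); rewrite lte_fin /= /e; lra.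
Qed.

(** Plays the role of extracting a subsequence; iterating it makes several
    sequences converge along the same filter of indices. *)
Lemma cluster_refine {S : Type} {X : topologicalType} (F : set_system S)
    {FF : Filter F} (u : S -> X) (l : X) : cluster (u @ F) l ->
  exists G : set_system S, [/\ ProperFilter G, F `<=` G & u @ G --> l].
Proof.
move=> cl.
pose D := [set AB : set S * set X | F AB.1 /\ nbhs l AB.2].
pose B (AB : set S * set X) := AB.1 `&` u @^-1` AB.2.
exists (filter_from D B); split.
- apply: filter_from_proper; last first.
    move=> [A V] [/= FA lV].
    have FuA : F (u @^-1` (u @` A)) by apply: filterS FA => s As; exists s.
    have [_ [[s As <-] Vus]] := cl (u @` A) V FuA lV.
    by exists s.
  apply: filter_from_filter.
    by exists (setT, setT); split; exact: filterT.
  move=> [A V] [A' V'] [/= FA lV] [/= FA' lV'].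
  exists (A `&` A', V `&` V'); first by split; exact: filterI.
  by move=> s [[As A's] [Vs V's]].
- move=> A FA; exists (A, setT); first by split => //; exact: filterT.
  by move=> s [].
- move=> V lV; exists (setT, V); first by split => //; exact: filterT.
  by move=> s [].
Qed.

(** * Proximal points and subgradients of convex functions *)

Lemma convex_segment {R : realType} {n : nat} (f : 'cV[R]_n -> R) :
  convex_function [set: 'cV[R]_n] f ->
  forall x y t, 0 <= t -> t <= 1 ->
    f (x + t *: (y - x)) <= f x + t * (f y - f x).
Proof.
move=> cf x y t t0 t1.
have := cf (Itv01 t0 t1) y x (in_setT _) (in_setT _).
have -> : conv (Itv01 t0 t1) (y : convex_lmodType 'cV[R]_n) x = x + t *: (y - x).
  rewrite -[LHS]/(t *: y + (1 - t) *: x) scalerBl scale1r scalerBr.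
  by rewrite addrCA.
move/le_trans; apply; rewrite le_eqVlt; apply/orP; left; apply/eqP.
by rewrite -[LHS]/(t * f y + (1 - t) * f x); ring.
Qed.

(** First-order optimality: let t tend to 0. *)
Lemma ge0_of_affine {R : realType} (a b : R) :
  (forall t, 0 < t -> t <= 1 -> 0 <= a + t * b) -> 0 <= a.
Proof.
move=> ab; rewrite leNgt; apply/negP => a0.
have b0 : 0 < b by have := ab 1 ltr01 (lexx _); lra.
have := ab (- a / (- a + b)).
have d0 : 0 < - a + b by lra.
rewrite divr_gt0 ?oppr_gt0 // ler_pdivrMr // mul1r.
have -> : a + - a / (- a + b) * b = - (a ^+ 2 / (- a + b)).
  by field; rewrite gt_eqF.
rewrite oppr_ge0 => H.
have : 0 < a ^+ 2 / (- a + b) by rewrite divr_gt0 // exprn_even_gt0 //= lt_eqF.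
by have := H isT; lra.
Qed.

Section Prox.
Context {R : realType} {n : nat}.
Implicit Types (psi phi : 'cV[R]_n -> R) (xb y z : 'cV[R]_n) (g r : R).

Lemma compact_norm_ball xb r : compact [set z | `|xb - z| <= r].
Proof.
apply: bounded_closed_compact_cV.
  exists (`|xb| + r); split; first by rewrite num_real.
  move=> M lM z /= zr; apply: le_trans (ltW lM).
  by rewrite -(subKr xb z); apply: le_trans (ler_normB _ _) _; rewrite lerD2l.
have /continuous_closedP := @norm_subl_continuous R 'cV[R]_n xb.
by move=> /(_ [set t | t <= r]); apply; exact: closed_le.
Qed.

(** A convex function bounded below by c on the unit ball around xb decreases
    at most linearly in the distance r >= 1 from xb: psi z - psi xb is at
    least r * (c - psi xb).  The quadratic term therefore wins outside a ball of
    radius rho, and inside that compact ball the minimum is attained by lower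
    semicontinuity. *)
Lemma convex_prox_exists psi xb g : 0 < g ->
  convex_function [set: 'cV[R]_n] psi -> lower_semicontinuous (EFin \o psi) ->
  exists p, forall z, psi p + g / 2 * enorm (xb - p) ^+ 2
                      <= psi z + g / 2 * enorm (xb - z) ^+ 2.
Proof.
move=> g0 cpsi lpsi.
have [p1 Bp1 p1min] : exists2 x, [set z | `|xb - z| <= 1] x &
    forall y, [set z | `|xb - z| <= 1] y -> psi x <= psi y.
  apply: lower_semicontinuous_compact_min => //; first exact: compact_norm_ball.
  by exists xb => /=; rewrite subrr normr0.
pose rho := Num.max 1 (2 * (psi xb - psi p1) / g).
pose q z := g / 2 * enorm (xb - z) ^+ 2.
have cq : continuous q.
  rewrite /q; under eq_fun do rewrite enorm_sqr.
  have cd := continuous_dotv (@subl_continuous R 'cV[R]_n xb)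
                             (@subl_continuous R 'cV[R]_n xb).
  by move=> z; apply: (cvgMl_tmp (cd z)).
have [p Kp pmin] : exists2 x, [set z | `|xb - z| <= rho] x &
    forall y, [set z | `|xb - z| <= rho] y -> (psi \+ q) x <= (psi \+ q) y.
  apply: lower_semicontinuous_compact_min.
  - exact: lower_semicontinuousD_continuous.
  - exact: compact_norm_ball.
  - by exists xb => /=; rewrite subrr normr0 le_max ler01.
exists p => z; have [/pmin //|zr] := leP `|xb - z| rho.
have /pmin pxb : [set z | `|xb - z| <= rho] xb.
  by rewrite /= subrr normr0 le_max ler01.
apply: le_trans pxb _; rewrite /= /q subrr enorm_sqr dotv0r mulr0 addr0.
set r := `|xb - z| in zr.
have r1 : 1 < r by apply: le_lt_trans zr; rewrite le_max lexx.
have r0 : 0 < r by apply: lt_trans r1.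
have gr : 2 * (psi xb - psi p1) < r * g.
  by rewrite -ltr_pdivrMr //; apply: le_lt_trans zr; rewrite le_max lexx orbT.
(* The point of the segment from xb to z at distance 1 from xb. *)
have Bz : [set z | `|xb - z| <= 1] (xb + r^-1 *: (z - xb)).
  rewrite /= opprD addrA subrr sub0r normrN normrZ distrC -/r.
  have rn0 : r != 0 by rewrite gt_eqF.
  by rewrite ger0_norm ?mulVf ?invr_ge0 // ltW.
have H1 := p1min _ Bz.
have H2 : psi (xb + r^-1 *: (z - xb)) <= psi xb + r^-1 * (psi z - psi xb).
  apply: (convex_segment cpsi); first by rewrite invr_ge0 ltW.
  by rewrite invf_le1 // ltW.
have H3 : r * (psi p1 - psi xb) <= psi z - psi xb.
  rewrite mulrC -ler_pdivlMr // mulrC.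
  by have := le_trans H1 H2; lra.
have H4 : r ^+ 2 <= enorm (xb - z) ^+ 2 by rewrite enorm_sqr norm_sqr_le.
have H5 : g / 2 * r ^+ 2 <= g / 2 * enorm (xb - z) ^+ 2.
  by rewrite ler_pM2l // divr_gt0.
have H6 : r * (psi xb - psi p1) <= g / 2 * r ^+ 2.
  have -> : g / 2 * r ^+ 2 = r * (r * g / 2) by ring.
  by rewrite ler_pM2l //; move: gr; lra.
move: H3 H5 H6; rewrite !mulrBr; lra.
Qed.

Section ProxPoint.
Variables (phi : 'cV[R]_n -> R) (xb y : 'cV[R]_n) (g : R).
Hypotheses (g0 : 0 < g) (cphi : convex_function [set: 'cV[R]_n] phi)
  (lphi : lower_semicontinuous (EFin \o phi)).

Let p := prox phi xb y g.

Lemma prox_argmin z :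
  dotv y p + phi p + g / 2 * enorm (xb - p) ^+ 2 <=
  dotv y z + phi z + g / 2 * enorm (xb - z) ^+ 2.
Proof.
have [||q qmin] := @convex_prox_exists (phi \+ dotv y) xb g g0.
- move=> t u w uT wT; have := cphi t uT wT.
  rewrite -[X in _ <= X -> _]/(t%:num * phi u + (1 - t%:num) * phi w).
  rewrite -[X in _ -> _ <= X]/(t%:num * (phi u + dotv y u) + (1 - t%:num) * (phi w + dotv y w)).
  rewrite -[conv t _ _]/(t%:num *: u + (1 - t%:num) *: w) /= dotvDr !dotvZr.
  by set A := phi _; lra.
- apply: lower_semicontinuousD_continuous => //.
  by apply: (@continuous_dotv _ _ _ (cst y) id); [exact: cst_continuous | move=> u A].
have : argmin (fun x => dotv y x + phi x + g / 2 * enorm (xb - x) ^+ 2) p.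
  apply: getPex; exists q => u /=; rewrite (addrC (dotv y q)) (addrC (dotv y u)).
  exact: qmin.
exact.
Qed.

(** The optimality condition says that g (xb - p) - y is a subgradient of phi
    at p; it comes from comparing p with p + t (z - p) as t tends to 0. *)
Lemma prox_subgrad z : phi p + dotv (g *: (xb - p) - y) (z - p) <= phi z.
Proof.
rewrite -subr_ge0.
apply: (@ge0_of_affine _ _ (g / 2 * enorm (z - p) ^+ 2)) => t t0 t1.
rewrite -(pmulr_rge0 _ t0).
have := prox_argmin (p + t *: (z - p)).
have := convex_segment cphi p z (ltW t0) t1.
have -> : xb - (p + t *: (z - p)) = (xb - p) - t *: (z - p) by rewrite opprD addrA.
set w := z - p; set e := xb - p.
rewrite (enorm_sqrB e (t *: w)) !enorm_sqr dotvDr (dotvBl (g *: e)) !dotvZl !dotvZr.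
set A := phi (p + _); lra.
Qed.

End ProxPoint.
End Prox.

(** If h is bounded by C on the ball of radius M + 1, testing a subgradient at
    a point of the ball of radius M against the unit steps in the coordinate
    directions bounds each coordinate by 2 C. *)
Lemma subdiff_locally_bounded {R : realType} {n : nat} (h : 'cV[R]_n -> R)
    (M : R) : continuous h ->
  exists C, forall x v, `|x| <= M -> subdiff h x v -> `|v| <= C.
Proof.
move=> ch.
have K : compact [set z : 'cV[R]_n | `|0 - z| <= M + 1] by exact: compact_norm_ball.
have := compact_bounded (continuous_compact (continuous_subspaceT ch) K).
move=> /ex_strict_bound_gt0[C C0 hC]; exists (2 * C) => x v xM vx.
have hb z : `|z| <= M + 1 -> `|h z| < C.
  by move=> zM; apply: hC; exists z => //=; rewrite sub0r normrN.
apply: norm_le_coord => [|j]; first by rewrite mulr_ge0 // ltW.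
have key (w : 'cV[R]_n) : `|w| <= 1 -> dotv v w <= 2 * C.
  move=> w1; have := vx (x + w); rewrite addrAC subrr add0r.
  have /hb : `|x + w| <= M + 1 by apply: le_trans (ler_normD _ _) _; exact: lerD.
  have /hb : `|x| <= M + 1 by apply: le_trans xM _; rewrite lerDl.
  by rewrite !ltr_norml => /andP[? ?] /andP[? ?]; lra.
have dv : dotv v (delta_mx j 0) = v j 0.
  rewrite /dotv (bigD1 j) //= mxE !eqxx mulr1 big1 ?addr0 // => k kj.
  by rewrite mxE (negbTE kj) mulr0.
have d1 : `|delta_mx j 0 : 'cV[R]_n| <= 1.
  by apply: norm_le_coord => // k; rewrite mxE normr_nat lern1 leq_b1.
rewrite ler_norml; apply/andP; split.
  by rewrite lerNl -dv -dotvNr; apply: key; rewrite normrN.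
by rewrite -dv; exact: key.
Qed.

(** * Quadratic upper bounds along a line *)

Lemma dotv_grad {R : realType} {n : nat} (f : 'cV[R]_n -> R) x w :
  differentiable f x -> 'D_w f x = dotv (grad f x) w.
Proof.
move=> df; rewrite deriveE // [in LHS](matrix_sum_delta w) linear_sum.
by apply: eq_bigr => j _; rewrite big_ord1 linearZ /= mxE deriveE // mulrC.
Qed.

(** The difference quotient of r |-> f (x + r w) at s is literally the one that
    defines the directional derivative at x + s w. *)
Lemma is_derive_line {R : realType} {n : nat} (f : 'cV[R]_n -> R) x w (s : R) :
  (forall z, differentiable f z) ->
  is_derive s 1 (fun r => f (x + r *: w)) (dotv (grad f (x + s *: w)) w).
Proof.
move=> df; set z := x + s *: w.
have E : (fun h : R => h^-1 *: (((fun r => f (x + r *: w)) \o shift s) (h *: 1)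
            - f (x + s *: w))) =
         (fun h => h^-1 *: ((f \o shift z) (h *: w) - f z)).
  apply/funext => h; congr (_ *: (f _ - _)); rewrite /= /z.
  by rewrite [h%:A]mulr1 scalerDl addrCA.
have dz : derivable f z w by exact: diff_derivable.
apply: DeriveDef.
  by rewrite /derivable E.
by rewrite -dotv_grad // /derive E.
Qed.

(** Apply the mean value theorem to f (x + r w) minus its first-order
    expansion and r^2 b / 2: the derivative is nonpositive, which keeps the
    constant 1/2 that a bound on f alone would lose. *)
Lemma descent_line {R : realType} {n : nat} (f : 'cV[R]_n -> R) x w (b : R) :
  (forall z, differentiable f z) ->
  (forall s, 0 < s -> dotv (grad f (x + s *: w) - grad f x) w <= s * b) ->
  f (x + w) <= f x + dotv (grad f x) w + b / 2.
Proof.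
move=> df H.
set a := dotv (grad f x) w.
pose g (r : R) := f (x + r *: w) - r * a - r ^+ 2 * (b / 2).
have dg (r : R) : is_derive r 1 g (dotv (grad f (x + r *: w)) w - a - r * b).
  have df1 := is_derive_line x w r df.
  rewrite /g; apply: is_derive_eq.
  by set G := dotv (grad f _) w; rewrite /GRing.scale /=; field.
have [|c] := @MVT R g _ 0 1 ltr01 (fun r _ => dg r).
  by apply: derivable_within_continuous => r _; exact: (@ex_derive _ _ _ _ _ _ _ (dg r)).
rewrite in_itv /= => /andP[c0 _].
have := H _ c0; rewrite dotvBl -/a.
rewrite /g scale0r addr0 scale1r expr0n /= expr1n; lra.
Qed.

(** * Block decomposition *)

Section Blocks.
Context {R : realType} {m : nat} {d_ : 'I_m -> nat}.
Local Notation d := (\sum_(i < m) d_ i)%N.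
Variable U : forall i : 'I_m, 'M[R]_(d, d_ i).
Hypothesis hU : \mxrow_(i < m) U i = 1%:M.
Implicit Types (x y : 'cV[R]_d) (i j : 'I_m).

(** This identity and the orthogonality of distinct blocks below read the
    same hypothesis on the two sides: the product of the concatenation of the
    U i with its transpose, and of its transpose with it, are both 1. *)
Lemma sum_blk x : \sum_(i < m) U i *m blk U i x = x.
Proof.
have := mul_mxrow_mxcol U (fun i => (U i)^T).
rewrite -tr_mxrow hU trmx1 mul1mx => H.
rewrite -[RHS]mul1mx H mulmx_suml.
by apply: eq_bigr => i _; rewrite mulmxA.
Qed.

Lemma mxdiag_tr_mul : \mxdiag_(i < m) (1%:M : 'M[R]_(d_ i)) =
  \mxblock_(i < m, j < m) ((U i)^T *m U j).
Proof. by rewrite -mul_mxcol_mxrow -tr_mxrow hU trmx1 mul1mx mxdiagZ. Qed.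

Lemma blk_mul_eq i (t : 'cV[R]_(d_ i)) : blk U i (U i *m t) = t.
Proof.
have /(congr1 (fun A => submxblock A i i)) := mxdiag_tr_mul.
by rewrite submxblock_diag mxblockK /blk mulmxA => <-; rewrite mul1mx.
Qed.

Lemma blk_mul_neq i j (t : 'cV[R]_(d_ i)) : j != i -> blk U j (U i *m t) = 0.
Proof.
move=> /negbTE ji; have /(congr1 (fun A => submxblock A j i)) := mxdiag_tr_mul.
by rewrite /mxdiag !mxblockK ji /blk mulmxA => <-; rewrite mul0mx.
Qed.

Lemma blkB i x y : blk U i (x - y) = blk U i x - blk U i y.
Proof. exact: mulmxBr. Qed.

Lemma blkD i x y : blk U i (x + y) = blk U i x + blk U i y.
Proof. exact: mulmxDr. Qed.

Lemma blk_sum_mul i (t : forall i, 'cV[R]_(d_ i)) :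
  blk U i (\sum_(j < m) U j *m t j) = t i.
Proof.
rewrite /blk mulmx_sumr (bigD1 i) //= -/(blk U i _) blk_mul_eq.
rewrite big1 ?addr0 // => j; rewrite eq_sym => ij; exact: blk_mul_neq.
Qed.

Lemma blk_inj x y : (forall i, blk U i x = blk U i y) -> x = y.
Proof.
by move=> xy; rewrite -(sum_blk x) -(sum_blk y); apply: eq_bigr => i _; rewrite xy.
Qed.

Lemma dotv_blk x y : dotv x y = \sum_(i < m) dotv (blk U i x) (blk U i y).
Proof.
rewrite -[in LHS](sum_blk y) (big_morph _ (dotvDr x) (dotv0r x)).
by apply: eq_bigr => i _; rewrite dotv_mulmxr.
Qed.

Lemma block_descent f (L : 'I_m -> R) x i (t : 'cV[R]_(d_ i)) :
  (forall z, differentiable f z) -> 0 < L i -> block_smooth U f L ->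
  f (x + U i *m t) <= f x + dotv (blk U i (grad f x)) t + L i / 2 * dotv t t.
Proof.
move=> df L0 fL; rewrite -dotv_mulmxr.
have -> : L i / 2 * dotv t t = L i * dotv t t / 2 by ring.
apply: descent_line => // s s0.
rewrite dotv_mulmxr -/(blk U i _) blkB.
have := fL i x (s *: t); rewrite -scalemxAr.
set w := blk U i (grad f x); set w' := blk U i _ => H.
have H1 : enorm (w' - w) <= s * L i * enorm t.
  move: H; rewrite /enorm dotvZl dotvZr mulrA -expr2 sqrtrM ?sqr_ge0 //.
  rewrite sqrtr_sqr gtr0_norm // => H; apply: le_trans (le_trans _ H) _.
    by rewrite -opprB dotvNl dotvNr opprK.
  by rewrite mulrA (mulrC s).
have := dotv_le_of_enorm (mulr_gt0 s0 L0) H1.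
by rewrite mulrA.
Qed.

End Blocks.

(** * One block step, and limits of vanishing steps *)

Section Step.
Context {R : realType} {m : nat} {d_ : 'I_m -> nat}.
Local Notation d := (\sum_(i < m) d_ i)%N.
Variable U : forall i : 'I_m, 'M[R]_(d, d_ i).
Hypothesis hU : \mxrow_(i < m) U i = 1%:M.
Variables (f h : 'cV[R]_d -> R) (phi : forall i : 'I_m, 'cV[R]_(d_ i) -> R).
Arguments phi : clear implicits.
Variable gam : 'I_m -> R.
Hypothesis gam_gt0 : forall i, 0 < gam i.
Hypothesis phi_convex : forall i, convex_function [set: 'cV[R]_(d_ i)] (phi i).
Hypothesis phi_lsc : forall i, lower_semicontinuous (EFin \o phi i).

(** With t the step of the block, the descent lemma gives + L / 2 |t|^2, the
    optimality of the proximal point tested at the old block gives - gam |t|^2,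
    and the terms linear in t cancel against the linearization of h. *)
Lemma block_step_decrease (L : 'I_m -> R) (x v xn : 'cV[R]_d) i :
  (forall z, differentiable f z) -> 0 < L i -> block_smooth U f L ->
  subdiff h x v ->
  blk U i xn = block_update U f phi gam x v i ->
  (forall j, j != i -> blk U j xn = blk U j x) ->
  objective U f phi h xn
    + (gam i - L i / 2) * enorm (blk U i x - block_update U f phi gam x v i) ^+ 2
  <= objective U f phi h x.
Proof.
move=> df L0 fL vx xni xnj.
pose q := block_update U f phi gam x v i.
pose t := q - blk U i x.
have exn : xn = x + U i *m t.
  apply: (blk_inj hU) => j; rewrite blkD.
  have [->|ji] := eqVneq j i; last by rewrite xnj // blk_mul_neq // addr0.
  by rewrite xni blk_mul_eq // addrC subrK.
have Hf := block_descent x t df L0 fL.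
have Hh := vx xn; rewrite exn addrAC subrr add0r dotv_mulmxr in Hh.
have Hphi : phi i q + dotv (gam i *: (blk U i x - q)
    - (blk U i (grad f x) - blk U i v)) (blk U i x - q) <= phi i (blk U i x).
  exact: prox_subgrad.
have Hsep : separable U phi xn = separable U phi x - phi i (blk U i x) + phi i q.
  rewrite /separable (bigD1 i) //= [in RHS](bigD1 i) //= xni -/q.
  rewrite (eq_bigr (fun j => phi j (blk U j x))); first by ring.
  by move=> j /xnj ->.
rewrite /objective Hsep exn -/q.
have Et : blk U i x - q = - t by rewrite opprB.
rewrite Et in Hphi *; rewrite -exn; clearbody t.
rewrite enorm_sqr dotvNl dotvNr opprK.
move: Hf Hh Hphi; rewrite -exn -!/(blk U i _) dotvNr scalerN !dotvBl dotvNl dotvZl.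
lra.
Qed.

(** If all proximal steps vanish, the proximal points of block i and the
    blocks x^k_i share their limits, so the optimality conditions of the
    proximal problems become the criticality condition. *)
Lemma limit_points_critical (x v : nat -> 'cV[R]_d) :
  continuous (grad f) -> continuous h -> bounded_set (range x) ->
  (forall k, subdiff h (x k) (v k)) ->
  (forall i, (fun k => enorm (blk U i (x k)
      - block_update U f phi gam (x k) (v k) i) ^+ 2) @ \oo --> 0) ->
  cluster (x @ \oo) `<=` critical U f phi h.
Proof.
move=> cgrad ch bx vx step0 xc clx.
have [M M0 xM] := ex_strict_bound_gt0 bx.
have [C vC] := subdiff_locally_bounded M ch.
(* Along G1 the iterates converge; along the finer G so do the subgradients. *)
have [G1 [G1p G1oo x1]] := cluster_refine clx.
have [vb [_ clv]] : [set z : 'cV[R]_d | `|0 - z| <= C] `&` cluster (v @ G1) !=set0.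
  apply: compact_norm_ball; apply: (@filterE _ G1) => k /=.
  rewrite sub0r normrN; apply: (vC (x k)) => //; apply: ltW; apply: xM.
  by exists k.
have [G [Gp G1G vG]] := cluster_refine clv.
have xG : x @ G --> xc by move=> V /x1 /G1G.
have stepG i : (fun k => enorm (blk U i (x k)
      - block_update U f phi gam (x k) (v k) i) ^+ 2) @ G --> 0.
  by move=> V /(step0 i) /G1oo /G1G.
exists vb; split; last first.
  move=> y; apply: (@lower_semicontinuous_limit_le _ _ _ G _ h x
    (fun k => dotv (v k) (y - x k))) => //.
  - exact: continuous_lower_semicontinuous.
  - by apply: cvg_dotv => //; apply: cvgB => //; exact: cvg_cst.
  - by move=> k; exact: vx.
exists (vb - grad f xc); last by rewrite addrC subrK.
move=> y; rewrite /separable (dotv_blk hU) -big_split /=; apply: ler_sum => i _.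
pose q k := block_update U f phi gam (x k) (v k) i.
have rG : (fun k => blk U i (x k) - q k) @ G --> (0 : 'cV[R]_(d_ i)).
  by apply: cvg0_enorm; exact: stepG.
have xiG : (fun k => blk U i (x k)) @ G --> blk U i xc by exact: mulmx_cvg.
have qG : q @ G --> blk U i xc.
  have -> : q = (fun k => blk U i (x k) - (blk U i (x k) - q k)).
    by apply/funext => k; rewrite opprB addrC subrK.
  by rewrite -[blk U i xc]subr0; exact: cvgB.
apply: (@lower_semicontinuous_limit_le _ _ _ G _ (phi i) q (fun k => dotv
  (gam i *: (blk U i (x k) - q k) - (blk U i (grad f (x k)) - blk U i (v k)))
  (blk U i y - q k))) => //.
- apply: cvg_dotv; last first.
    by rewrite blkB; apply: cvgB => //; exact: cvg_cst.
  have -> : blk U i (vb - grad f xc) = gam i *: 0 - (blk U i (grad f xc) - blk U i vb).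
    by rewrite scaler0 sub0r opprB blkB.
  apply: cvgB; first by apply: cvgZl_tmp.
  apply: cvgB; apply: mulmx_cvg => //.
  exact: (continuous_cvg _ (cgrad xc)).
- by move=> k; exact: prox_subgrad.
Qed.

End Step.

(** * Expectations over the sampling history *)

Section FiniteValued.
Context {R : realType} {disp : measure_display} {T : measurableType disp}.
Context {A : finType} (X : T -> A).
Hypothesis mX : forall a, measurable [set w | X w = a].

Lemma finite_valuedE (g : A -> R) w :
  g (X w) = \sum_a g a * \1_[set w | X w = a] w.
Proof.
rewrite (bigD1 (X w)) //= indicE mem_set // mulr1 big1 ?addr0 // => a aX.
by rewrite indicE memNset ?mulr0 //= => Xa; rewrite Xa eqxx in aX.
Qed.

Lemma measurable_finite_valued (g : A -> R) :
  measurable_fun [set: T] (fun w => g (X w)).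
Proof.
under eq_fun do rewrite finite_valuedE.
apply: measurable_sum => a; apply: measurable_funM; first exact: measurable_cst.
exact: measurable_indic.
Qed.

Lemma integral_finite_valued (P : probability T R) (g : A -> R) :
  (forall a, 0 <= g a) ->
  (\int[P]_w (g (X w))%:E = \sum_a (g a)%:E * P [set w | X w = a])%E.
Proof.
move=> g0; under eq_integral do rewrite finite_valuedE -sumEFin.
rewrite ge0_integral_sum //; first last.
- by move=> a w _; rewrite lee_fin mulr_ge0.
- move=> a; apply/measurable_EFinP; apply: measurable_funM.
    exact: measurable_cst.
  exact: measurable_indic.
apply: eq_bigr => a _; under eq_integral do rewrite EFinM.
rewrite ge0_integralZl_EFin //.
- by rewrite integral_indic // setIT.
- by apply/measurable_EFinP; exact: measurable_indic.
Qed.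

End FiniteValued.

(** By monotone convergence the series of the G k is integrable, hence finite
    almost everywhere, and the terms of a convergent series tend to 0. *)
Lemma summable_integral_ae_cvg0 {R : realType} {disp : measure_display}
    {T : measurableType disp} (mu : {measure set T -> \bar R})
    (G : nat -> T -> R) (C : R) :
  (forall k, measurable_fun [set: T] (G k)) -> (forall k w, 0 <= G k w) ->
  (forall K, \sum_(0 <= k < K) \int[mu]_w (G k w)%:E <= C%:E)%E ->
  {ae mu, forall w, G ^~ w @ \oo --> 0}.
Proof.
move=> mG G0 GC.
have mGE k : measurable_fun [set: T] (EFin \o G k) by exact/measurable_EFinP.
have GE0 k w : (0 <= (G k w)%:E)%E by rewrite lee_fin.
have GS w : (0 <= \sum_(k <oo) (G k w)%:E)%E by apply: nneseries_ge0.
have iS : mu.-integrable [set: T] (fun w => \sum_(k <oo) (G k w)%:E)%E.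
  apply/integrableP; split.
    apply: (@ge0_emeasurable_sum _ _ _ _ (fun k w => (G k w)%:E) xpredT) => k.
      by move=> w _ _; exact: GE0.
    by move=> _; exact: mGE.
  under eq_integral do rewrite gee0_abs //.
  rewrite integral_nneseries //; apply: (@le_lt_trans _ _ C%:E); last exact: ltry.
  apply: lime_le; last exact: nearW.
  by apply: is_cvg_nneseries => k _ _; exact: integral_ge0.
have := integrable_ae measurableT iS.
apply: filterS => w /(_ I) fw.
apply: cvg_series_cvg_0; apply: nnseries_is_cvg => //.
by rewrite ltey_eq fw.
Qed.

Section Sampling.
Context {R : realType} {m : nat} {disp : measure_display} {T : measurableType disp}.
Variables (P : probability T R) (p : 'I_m -> R) (I : nat -> T -> 'I_m).
Hypothesis hI : independent_sampling P p I.
Hypothesis p_ge0 : forall i, 0 <= p i.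

Definition adapted {Y : Type} (k : nat) (g : T -> Y) :=
  exists c : k.-tuple 'I_m -> Y, forall w, g w = c (history I k w).

Lemma measurable_history k (t : k.-tuple 'I_m) :
  measurable [set w | history I k w = t].
Proof.
have -> : [set w | history I k w = t] =
    \bigcap_(l in [set: 'I_k]) [set w | I l w = tnth t l].
  apply/seteqP; split => [w /= <- l _ /=|w /= H]; first by rewrite tnth_mktuple.
  by apply: eq_from_tnth => l; rewrite tnth_mktuple; exact: H.
apply: fin_bigcap_measurable; first exact: finite_finset.
by move=> l _; exact: (sampling_measurable hI).
Qed.

Lemma measurable_adapted k (g : T -> R) :
  adapted k g -> measurable_fun [set: T] g.
Proof.
move=> [c /funext ->]; apply: measurable_finite_valued; exact: measurable_history.
Qed.

Lemma history_next_set k (t : k.-tuple 'I_m) i :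
  [set w | (history I k w, I k w) = (t, i)] =
  [set w | I k w = i] `&` [set w | history I k w \in [set t]%SET].
Proof.
apply/seteqP; split => w /=; first by case=> <- <-; rewrite inE eqxx.
by case=> ->; rewrite inE => /eqP ->.
Qed.

Lemma measurable_history_next k (a : k.-tuple 'I_m * 'I_m) :
  measurable [set w | (history I k w, I k w) = a].
Proof.
case: a => t i; rewrite history_next_set; apply: measurableI.
  exact: (sampling_measurable hI).
rewrite (_ : mkset _ = [set w | history I k w = t]); first exact: measurable_history.
by apply/seteqP; split => w /=; rewrite inE => /eqP.
Qed.

(** This replaces conditioning on the past: as the history takes finitely many
    values, independence makes both sides the same double sum over histories
    and blocks. *)
Lemma integral_next_choice k (D : 'I_m -> T -> R) :
  (forall i w, 0 <= D i w) -> (forall i, adapted k (D i)) ->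
  (\int[P]_w (D (I k w) w)%:E = \int[P]_w (\sum_i p i * D i w)%:E)%E.
Proof.
move=> D0 /choice[c cD].
(* c i may be negative on tuples that no outcome realizes. *)
pose e i t := Num.max 0 (c i t).
have eD i w : D i w = e i (history I k w).
  by rewrite /e -cD; apply/esym/max_idPr.
have e0 i t : 0 <= e i t by rewrite le_max lexx.
under eq_integral do rewrite eD.
rewrite (integral_finite_valued (@measurable_history_next k) P
  (g := fun a => e a.2 a.1)) //.
under [in RHS]eq_integral do under eq_bigr do rewrite eD.
rewrite (integral_finite_valued (@measurable_history k) P
  (g := fun t => \sum_i p i * e i t)); last first.
  by move=> t; apply: sumr_ge0 => i _; rewrite mulr_ge0.
transitivity (\sum_t \sum_i (e i t)%:E *
  P [set w | (history I k w, I k w) = (t, i)])%E.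
  by rewrite pair_bigA; apply: eq_bigr => -[].
apply: eq_bigr => t _; rewrite -sumEFin ge0_sume_distrl; last first.
  by move=> i _; rewrite lee_fin mulr_ge0.
apply: eq_bigr => i _; rewrite history_next_set (sampling_indep hI).
rewrite (sampling_law hI) muleA -EFinM mulrC; congr (_ * P _)%E.
by apply/seteqP; split => w /=; rewrite inE => /eqP.
Qed.

(** Keeping the expectation of F K on the left makes the induction go through
    with nonnegative integrals only, without any subtraction of extended
    reals. *)
Lemma expected_decrease (F : nat -> T -> R) (D : nat -> 'I_m -> T -> R) (F0 : R) :
  (forall k w, 0 <= F k w) -> (forall k, adapted k (F k)) ->
  (forall k i w, 0 <= D k i w) -> (forall k i, adapted k (D k i)) ->
  (forall k w, F k.+1 w + D k (I k w) w <= F k w) ->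
  (forall w, F 0 w = F0) ->
  forall K, (\sum_(0 <= k < K) \int[P]_w (\sum_i p i * D k i w)%:E <= F0%:E)%E.
Proof.
move=> Fge0 aF Dge0 aD step F0E K.
have mF k : measurable_fun [set: T] (EFin \o F k).
  by apply/measurable_EFinP; exact: measurable_adapted.
have mD k : measurable_fun [set: T] (fun w => (D k (I k w) w)%:E).
  apply/measurable_EFinP.
  have /choice[c cD] := aD k.
  rewrite (_ : (fun w => _) = (fun w => c (I k w) (history I k w))).
    exact: (measurable_finite_valued (@measurable_history_next k)
      (fun a => c a.2 a.1)).
  by apply/funext => w; rewrite cD.
suff H : (\int[P]_w (F K w)%:E +
    \sum_(0 <= k < K) \int[P]_w (\sum_i p i * D k i w)%:E <= F0%:E)%E.
  apply: le_trans H; apply: leeDr; apply: integral_ge0 => w _.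
  by rewrite lee_fin.
elim: K => [|K IH].
  rewrite big_nil adde0; under eq_integral do rewrite F0E.
  by rewrite integral_cst // [X in (_ * X)%E]probability_setT mule1.
apply: le_trans IH; rewrite big_nat_recr //= addeCA addeC; apply: leeD2r.
rewrite -(@integral_next_choice K (D K)) // -ge0_integralD //; first last.
- by move=> w _; rewrite lee_fin.
- exact: mF.
- by move=> w _; rewrite lee_fin.
apply: ge0_le_integral => //.
- by move=> w _; rewrite lee_fin addr_ge0.
- by apply: emeasurable_funD; [exact: mF|exact: mD].
- exact: mF.
- by move=> w _; rewrite -EFinD lee_fin.
Qed.

End Sampling.

Lemma adapted_next {m : nat} {disp : measure_display} {T : measurableType disp}
    {Y : Type} (I : nat -> T -> 'I_m) k
    (c : k.-tuple 'I_m -> 'I_m -> Y) :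
  adapted I k.+1 (fun w => c (history I k w) (I k w)).
Proof.
exists (fun t => c [tuple tnth t (widen_ord (leqnSn k) l) | l < k]
                   (tnth t ord_max)) => w.
rewrite tnth_mktuple; congr (c _ _).
by apply: eq_from_tnth => l; rewrite !tnth_mktuple.
Qed.

(** * Runs of the algorithm *)

Section Run.
Context {R : realType} {m : nat} {d_ : 'I_m -> nat}.
Local Notation d := (\sum_(i < m) d_ i)%N.
Variable U : forall i : 'I_m, 'M[R]_(d, d_ i).
Hypothesis hU : \mxrow_(i < m) U i = 1%:M.
Variables (f h : 'cV[R]_d -> R) (phi : forall i : 'I_m, 'cV[R]_(d_ i) -> R).
Arguments phi : clear implicits.
Variables (L gam p : 'I_m -> R).
Hypothesis L_gt0 : forall i, 0 < L i.
Hypothesis f_diff : forall z, differentiable f z.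
Hypothesis f_smooth : block_smooth U f L.
Hypothesis phi_convex : forall i, convex_function [set: 'cV[R]_(d_ i)] (phi i).
Hypothesis phi_lsc : forall i, lower_semicontinuous (EFin \o phi i).
Hypothesis gam_gt : forall i, L i / 2 < gam i.
Context {disp : measure_display} {T : measurableType disp}.
Variables (I : nat -> T -> 'I_m) (x0 : 'cV[R]_d) (x v : nat -> T -> 'cV[R]_d).
Hypothesis run : RCSD U f phi h gam x0 I x v.

Let sqstep i k w :=
  enorm (blk U i (x k w) - block_update U f phi gam (x k w) (v k w) i) ^+ 2.

Let gam_gt0 i : 0 < gam i.
Proof. by apply: lt_trans (gam_gt i); rewrite divr_gt0. Qed.

Lemma RCSD_decrease k w :
  objective U f phi h (x k.+1 w)
    + (gam (I k w) - L (I k w) / 2) * sqstep (I k w) k w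
  <= objective U f phi h (x k w).
Proof.
apply: block_step_decrease => //.
- exact: (rcsd_subgrad run).
- exact: (rcsd_update run).
- by move=> j; exact: (rcsd_keep run).
Qed.

Lemma RCSD_objective_le k w :
  objective U f phi h (x k w) <= objective U f phi h x0.
Proof.
elim: k => [|k IH]; first by rewrite (rcsd_init run).
apply: le_trans IH; apply: le_trans (RCSD_decrease k w).
by rewrite lerDl mulr_ge0 ?sqr_ge0 // subr_ge0 ltW.
Qed.

Lemma RCSD_bounded w :
  (forall r : R, bounded_set [set y | objective U f phi h y <= r]) ->
  bounded_set (range (fun k => x k w)).
Proof.
move=> /(_ (objective U f phi h x0)) /ex_strict_bound_gt0[M M0 bM].
exists M; split; first exact: num_real.
move=> r Mr _ [k _ <-]; apply/ltW/(lt_trans _ Mr)/bM; exact: RCSD_objective_le.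
Qed.

(** Needed for measurability as well as for independence: the update rule
    turns a formula for the k-th pair in the history into one for the next. *)
Lemma RCSD_adapted k : adapted I k (fun w => (x k w, v k w)).
Proof.
elim: k => [|k [c xc]].
  have [cv vE] := rcsd_history run 0.
  by exists (fun t => (x0, cv t)) => w; rewrite (rcsd_init run) vE.
have [cv vE] := rcsd_history run k.+1.
pose nx t i := \sum_(j < m) U j *m
  (if j == i then block_update U f phi gam (c t).1 (c t).2 j else blk U j (c t).1).
have [cx xE] := adapted_next I nx.
exists (fun t => (cx t, cv t)) => w; rewrite vE -xE; congr (_, _).
apply: (blk_inj hU) => j; rewrite /nx (blk_sum_mul hU) -xc.
case: eqP => [->|/eqP ji]; first exact: (rcsd_update run).
exact: (rcsd_keep run).
Qed.

Lemma RCSD_adapted_comp (Y : Type) (g : 'cV[R]_d -> 'cV[R]_d -> Y) k :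
  adapted I k (fun w => g (x k w) (v k w)).
Proof.
by have [c xc] := RCSD_adapted k; exists (fun t => g (c t).1 (c t).2) => w; rewrite -xc.
Qed.

Variable P : probability T R.
Hypothesis sampling : independent_sampling P p I.
Hypothesis p_ge0 : forall i, 0 <= p i.

Lemma RCSD_expected_decrease (Fmin : R) :
  (forall y, Fmin <= objective U f phi h y) ->
  forall K, (\sum_(0 <= k < K) \int[P]_w
    (\sum_i p i * ((gam i - L i / 2) * sqstep i k w))%:E
    <= (objective U f phi h x0 - Fmin)%:E)%E.
Proof.
move=> Fm.
apply: (expected_decrease sampling p_ge0
  (F := fun k w => objective U f phi h (x k w) - Fmin)
  (D := fun k i w => (gam i - L i / 2) * sqstep i k w)).
- by move=> k w; rewrite subr_ge0.
- move=> k; exact: (RCSD_adapted_comp (fun y _ => objective U f phi h y - Fmin)).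
- by move=> k i w; rewrite mulr_ge0 ?sqr_ge0 // subr_ge0 ltW.
- move=> k i; exact: (RCSD_adapted_comp (fun y u => (gam i - L i / 2) *
    enorm (blk U i y - block_update U f phi gam y u i) ^+ 2)).
- by move=> k w; rewrite addrAC lerD2r RCSD_decrease.
- by move=> w; rewrite (rcsd_init run).
Qed.

(** The weights p i are positive, so the vanishing of the mean squared step
    forces the vanishing of the step of every block, also of those that are
    not sampled at that time. *)
Lemma RCSD_steps_ae_cvg0 (Fmin : R) :
  (forall y, Fmin <= objective U f phi h y) -> (forall i, 0 < p i) ->
  {ae P, forall w, forall i, sqstep i ^~ w @ \oo --> 0}.
Proof.
move=> Fm p0.
pose c i := p i * (gam i - L i / 2).
have c0 i : 0 < c i by rewrite mulr_gt0 // subr_gt0.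
pose G k w := \sum_i p i * ((gam i - L i / 2) * sqstep i k w).
have GE k w : G k w = \sum_i c i * sqstep i k w.
  by apply: eq_bigr => i _; rewrite mulrA.
have G0 k w : 0 <= G k w.
  by rewrite GE sumr_ge0 // => i _; rewrite mulr_ge0 ?sqr_ge0 // ltW.
have mG k : measurable_fun [set: T] (G k).
  apply: (measurable_adapted sampling).
  exact: (RCSD_adapted_comp (fun y u => \sum_i p i * ((gam i - L i / 2) *
    enorm (blk U i y - block_update U f phi gam y u i) ^+ 2))).
apply: filterS (summable_integral_ae_cvg0 mG G0 (RCSD_expected_decrease Fm)).
move=> w Gw i.
apply: (@squeeze_cvgr _ _ _ _ (fun=> 0) (fun k => (c i)^-1 * G k w)).
- apply: nearW => k; rewrite sqr_ge0 /=.
  rewrite ler_pdivlMl // GE (bigD1 i) //= lerDl sumr_ge0 // => j _.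
  by rewrite mulr_ge0 ?sqr_ge0 // ltW.
- exact: cvg_cst.
- by rewrite -[X in _ --> X](mulr0 (c i)^-1); apply: cvgMl_tmp.
Qed.

Lemma RCSD_limit_points_critical (Fmin : R) :
  (forall y, Fmin <= objective U f phi h y) -> (forall i, 0 < p i) ->
  continuous (grad f) -> continuous h ->
  (forall r : R, bounded_set [set y | objective U f phi h y <= r]) ->
  {ae P, forall w, cluster ((fun k => x k w) @ \oo) `<=` critical U f phi h}.
Proof.
move=> Fm p0 cgrad ch lev.
apply: filterS (RCSD_steps_ae_cvg0 Fm p0) => w step0.
apply: (limit_points_critical hU gam_gt0 phi_convex phi_lsc (v := v ^~ w)) => //.
- exact: RCSD_bounded.
- by move=> k; exact: (rcsd_subgrad run).
Qed.

Lemma dual_norm_composite_subgrad s y u :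
  dual_norm U L s (composite_subgrad U f phi gam y u) ^+ 2 =
  \sum_i L i `^ (- s) * gam i ^+ 2
     * enorm (blk U i y - block_update U f phi gam y u i) ^+ 2.
Proof.
rewrite sqr_sqrtr; last first.
  by apply: sumr_ge0 => i _; rewrite mulr_ge0 ?powR_ge0 ?sqr_ge0.
apply: eq_bigr => i _; rewrite (blk_sum_mul hU).
by rewrite !enorm_sqr dotvZl dotvZr; ring.
Qed.

End Run.

Lemma bigmin_le_average {R : realType} (E : nat -> \bar R) (C : R) (K : nat) :
  (forall k, (0 <= E k)%E) -> (\sum_(0 <= k < K.+1) E k <= C%:E)%E ->
  (\big[Order.min/+oo]_(k < K.+1) E k <= (C / K.+1%:R)%:E)%E.
Proof.
move=> E0 EC; set M := (\big[Order.min/+oo]_(k < K.+1) E k)%E.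
have ME k : (k < K.+1)%N -> (M <= E k)%E.
  by move=> kK; exact: (bigmin_le _ (Ordinal kK) (fun k : 'I_K.+1 => E k)).
have M0 : (0 <= M)%E by exact: le_bigmin.
have E0C : (E 0%N <= C%:E)%E.
  apply: le_trans EC; rewrite big_nat_recl //.
  by apply: leeDl; apply: sume_ge0.
have := le_trans (ME 0%N (ltn0Sn _)) E0C.
case: M M0 ME => [r| |] // r0 ME _.
rewrite lee_fin ler_pdivlMr // -lee_fin; apply: le_trans EC.
rewrite big_mkord.
have -> : (r * K.+1%:R)%:E = (\sum_(k < K.+1) r%:E)%E.
  by rewrite sumEFin sumr_const card_ord mulr_natr.
by apply: lee_sum => k _; exact: ME.
Qed.

Theorem theorem3 (R : realType) (m : nat) (d_ : 'I_m -> nat)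
  (U : forall i : 'I_m, 'M[R]_((\sum_(i < m) d_ i)%N, d_ i))
  (hU : \mxrow_(i < m) U i = 1%:M)
  (f h : 'cV[R]_(\sum_(i < m) d_ i) -> R)
  (phi : forall i : 'I_m, 'cV[R]_(d_ i) -> R)
  (L : 'I_m -> R)
  (hL : forall i, 0 < L i)
  (hf : continuously_differentiable f)
  (hfL : block_smooth U f L)
  (hphi_proper : forall i, proper (EFin \o phi i))
  (hphi_convex : forall i, convex_function [set: 'cV[R]_(d_ i)] (phi i))
  (hphi_lsc : forall i, lower_semicontinuous (EFin \o phi i))
  (hh_convex : convex_function [set: 'cV[R]_(\sum_(i < m) d_ i)] h)
  (hh_cont : continuous h)
  (hlevel : forall r : R, bounded_set [set y | objective U f phi h y <= r])
  (xstar : 'cV[R]_(\sum_(i < m) d_ i))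
  (hxstar : forall y, objective U f phi h xstar <= objective U f phi h y)
  (gam p : 'I_m -> R)
  (hgam : forall i, 0 < gam i)
  (hp : forall i, 0 < p i)
  (hp1 : \sum_(i < m) p i = 1)
  (disp : measure_display) (T : measurableType disp) (P : probability T R)
  (I : nat -> T -> 'I_m)
  (hI : independent_sampling P p I)
  (x0 : 'cV[R]_(\sum_(i < m) d_ i))
  (x v : nat -> T -> 'cV[R]_(\sum_(i < m) d_ i))
  (hx : RCSD U f phi h gam x0 I x v) :
  ((forall i, L i / 2 < gam i) ->
     (forall w, bounded_set (range (fun k => x k w))) /\
     {ae P, forall w,
        cluster ((fun k => x k w) @ \oo) `<=` critical U f phi h})
  /\
  ((forall i, gam i = L i) ->
   forall s : R, 0 <= s <= 1 ->
   (forall i, p i = L i `^ (1 - s) / \sum_(j < m) L j `^ (1 - s)) ->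
   forall K : nat,
   (\big[Order.min/+oo]_(k < K.+1)
      'E_P[fun w => (dual_norm U L s
                      (composite_subgrad U f phi gam (x k w) (v k w)) ^+ 2)%R]
    <= (2 * (\sum_(j < m) L j `^ (1 - s)) *
        (objective U f phi h x0 - objective U f phi h xstar)
        / K.+1%:R)%:E)%E).
Proof.
have [df cgrad] := hf; have p_ge0 i : 0 <= p i by rewrite ltW.
split=> [gam_gt|gamL s _ pE K].
  split=> [w|].
    exact: (RCSD_bounded hU hL df hfL hphi_convex hphi_lsc gam_gt hx).
  exact: (RCSD_limit_points_critical hU hL df hfL hphi_convex hphi_lsc gam_gt
    hx hI p_ge0 hxstar).
have gam_gt i : L i / 2 < gam i.
  by rewrite gamL ltr_pdivrMr // mulr_natr mulr2n ltrDl.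
set S := \sum_(j < m) L j `^ (1 - s) in pE *.
have S0 : 0 < S.
  rewrite lt_neqAle sumr_ge0 ?andbT => [|i _]; last exact: powR_ge0.
  apply/eqP => S0; move/eqP: hp1; rewrite big1 => [|i _]; first by rewrite eq_sym oner_eq0.
  by rewrite pE -S0 invr0 mulr0.
pose g k w := \sum_i p i * ((gam i - L i / 2) *
  enorm (blk U i (x k w) - block_update U f phi gam (x k w) (v k w) i) ^+ 2).
(* p i * (L i - L i / 2) is L i `^ (2 - s) / (2 * S), while the gradient
   mapping contributes L i `^ (- s) * L i ^+ 2. *)
have dualE k w : dual_norm U L s
    (composite_subgrad U f phi gam (x k w) (v k w)) ^+ 2 = 2 * S * g k w.
  rewrite dual_norm_composite_subgrad // mulr_sumr; apply: eq_bigr => i _.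
  rewrite pE gamL powRD ?(gt_eqF (hL i)) ?implybT // powRr1 ?ltW //.
  by field; rewrite gt_eqF.
apply: (@bigmin_le_average _ (fun k => 'E_P[fun w => (dual_norm U L s
    (composite_subgrad U f phi gam (x k w) (v k w)) ^+ 2)%R]%E)) => [k|].
  by rewrite unlock; apply: integral_ge0 => w _; rewrite lee_fin sqr_ge0.
have S2 : 0 <= 2 * S by rewrite mulr_ge0 // ltW.
have g0 k w : 0 <= g k w.
  apply: sumr_ge0 => i _; apply: mulr_ge0 => //; apply: mulr_ge0.
    by rewrite subr_ge0 ltW.
  exact: sqr_ge0.
have mg k : measurable_fun [set: T] (g k).
  apply: (measurable_adapted hI); exact: (RCSD_adapted_comp hU hx
    (fun y u => \sum_i p i * ((gam i - L i / 2) *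
      enorm (blk U i y - block_update U f phi gam y u i) ^+ 2))).
rewrite (eq_bigr (fun k => (2 * S)%:E * \int[P]_w (g k w)%:E)%E); last first.
  move=> k _; rewrite unlock; under eq_integral do rewrite dualE EFinM.
  rewrite ge0_integralZl_EFin //; first by move=> w _; rewrite lee_fin.
  exact/measurable_EFinP.
rewrite -ge0_sume_distrr; last first.
  by move=> k _; apply: integral_ge0 => w _; rewrite lee_fin.
rewrite [X in (_ <= X)%E]EFinM lee_wpmul2l ?lee_fin //.
exact: (RCSD_expected_decrease hU hL df hfL hphi_convex hphi_lsc gam_gt
    hx hI p_ge0 hxstar).
Qed.
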